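(* Let $\langle\Sigma,\tau\rangle$ be a transition system, let $L\subseteq\wp(\Sigma)$ be closed under arbitrary intersections and arbitrary unions and such that $\langle\Sigma,\sqsubseteq_L\rangle$ is a well-quasiordered set, and let $\Sigma_0,P\in\wp(\Sigma)$. Then Algorithm 1 and Algorithm 2 (both given in the context) coincide: they give the same output, i.e. either both return the same set $I\in L$ as an inductive invariant in $L$, or both return ''no inductive invariant in $L$'' (whatever counterexamples are chosen in Algorithm 2).
   Context: For $X\subseteq\Sigma$: $\mathrm{post}(X)=\{s'\mid\exists s\in X.\ (s,s')\in\tau\}$ and $\widetilde{\mathrm{pre}}(X)=\{s\mid\forall s'.\ (s,s')\in\tau\Rightarrow s'\in X\}$. $s\sqsubseteq_L s'$ iff for all $\phi\in L$, $s'\in\phi$ implies $s\in\phi$. A quasiordered set $D_\leq$ is well-quasiordered if every infinite sequence $(x_i)_{i\in\mathbb{N}}$ in $D$ has indices $i<j$ with $x_i\leq x_j$. $\hat\mu_L(X)=\bigcup\{\phi\in L\mid\phi\subseteq X\}$. $\mathrm{Av}_L(s)=\bigcup\{\phi\in L\mid s\notin\phi\}$. Closure under arbitrary intersections and unions includes the empty ones, so $\Sigma,\varnothing\in L$. A set $I$ is an inductive invariant if $\Sigma_0\subseteq I$, $\mathrm{post}(I)\subseteq I$ and $I\subseteq P$. For $I\supseteq\Sigma_0$, a counterexample to inductiveness of $I$ is a state $s\in I$ such that $\mathrm{post}(\{s\})\not\subseteq I$ or $s\notin P$. Algorithm 1 (co-inductive backward synthesis): set $I_1:=\Sigma$; while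 $\Sigma_0\subseteq I_1$: if $I_1=\hat\mu_L(\widetilde{\mathrm{pre}}(I_1)\cap I_1\cap P)$, return $I_1$ as an inductive invariant in $L$; otherwise set $I_1:=I_1\cap\hat\mu_L(\widetilde{\mathrm{pre}}(I_1)\cap I_1\cap P)$. After the loop, return ''no inductive invariant in $L$''. Algorithm 2: set $I_2:=\Sigma$; while $I_2$ is not an inductive invariant: if $\Sigma_0\not\subseteq I_2$, return ''no inductive invariant in $L$''; choose $s\in\Sigma$ as a counterexample to inductiveness of $I_2$; set $I_2:=I_2\cap\mathrm{Av}_L(s)$. After the loop, return $I_2$ as an inductive invariant in $L$. *)

(* Defs.v *)
From Stdlib Require Import Relations.
From mathcomp Require Import all_boot.
From mathcomp Require Import boolp classical_sets.

Set Implicit Arguments.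
Unset Strict Implicit.
Unset Printing Implicit Defensive.

Local Open Scope classical_set_scope.

Definition well_quasiorder (T : Type) (le : relation T) : Prop :=
  Relation_Definitions.preorder T le /\
  forall x : nat -> T, exists i j : nat, (i < j)%N /\ le (x i) (x j).

(* The empty families F are included, so these force setT and set0 into L. *)
Definition closed_under_bigcap (T : Type) (L : set (set T)) : Prop :=
  forall F : set (set T), F `<=` L -> L (\bigcap_(phi in F) phi).

Definition closed_under_bigcup (T : Type) (L : set (set T)) : Prop :=
  forall F : set (set T), F `<=` L -> L (\bigcup_(phi in F) phi).

Section TransitionSystem.
Variables (Sigma : Type) (tau : set (Sigma * Sigma)).
Implicit Types (X I : set Sigma) (s : Sigma).

Definition post X : set Sigma :=
  [set s' | exists2 s, X s & tau (s, s')].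

Definition pre_tilde X : set Sigma :=
  [set s | forall s', tau (s, s') -> X s'].

Variable L : set (set Sigma).

(* The direction is reversed: the members of L are downward closed. *)
Definition qo_of : relation Sigma :=
  fun s s' => forall phi, L phi -> phi s' -> phi s.

Definition mu_hat X : set Sigma :=
  \bigcup_(phi in [set phi | L phi /\ phi `<=` X]) phi.

Definition Av s : set Sigma :=
  \bigcup_(phi in [set phi | L phi /\ ~ phi s]) phi.

Variables (Sigma0 P : set Sigma).

Definition inductive_invariant I : Prop :=
  [/\ Sigma0 `<=` I, post I `<=` I & I `<=` P].

Definition counterexample I s : Prop :=
  I s /\ (~ (post [set s] `<=` I) \/ ~ P s).

End TransitionSystem.

Inductive output (Sigma : Type) : Type :=
| Invariant of set Sigma
| NoInvariant.
Arguments NoInvariant {Sigma}.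

(* [Running I]: control is at the head of the while loop, and the loop
   variable has value I. *)
Inductive config (Sigma : Type) : Type :=
| Running of set Sigma
| Returned of output Sigma.

Section Algorithms.
Variables (Sigma : Type) (tau : set (Sigma * Sigma)) (L : set (set Sigma)).
Variables (Sigma0 P : set Sigma).

Local Notation mu_step I := (mu_hat L (pre_tilde tau I `&` I `&` P)).

Inductive alg1_step : relation (config Sigma) :=
| Alg1Return I :
    Sigma0 `<=` I -> I = mu_step I ->
    alg1_step (Running I) (Returned (Invariant I))
| Alg1Refine I :
    Sigma0 `<=` I -> I <> mu_step I ->
    alg1_step (Running I) (Running (I `&` mu_step I))
| Alg1Exit I :
    ~ (Sigma0 `<=` I) ->
    alg1_step (Running I) (Returned NoInvariant).

Local Notation is_inv I := (inductive_invariant tau Sigma0 P I).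

Inductive alg2_step : relation (config Sigma) :=
| Alg2Fail I :
    ~ is_inv I -> ~ (Sigma0 `<=` I) ->
    alg2_step (Running I) (Returned NoInvariant)
| Alg2Refine I s :
    ~ is_inv I -> Sigma0 `<=` I -> counterexample tau P I s ->
    alg2_step (Running I) (Running (I `&` Av L s))
| Alg2Exit I :
    is_inv I ->
    alg2_step (Running I) (Returned (Invariant I)).

End Algorithms.

(* Every execution started with the loop variable equal to setT is finite and,
   when it cannot be continued, has returned o.  All resolutions of the
   nondeterminism in [step] are covered, and a stuck [Running] configuration
   is not a successful termination. *)
Definition returns (Sigma : Type) (step : relation (config Sigma))
    (o : output Sigma) : Prop :=
  (~ exists c : nat -> config Sigma,
       c 0%N = Running setT /\ forall n, step (c n) (c n.+1)) /\
  (forall c, clos_refl_trans _ step (Running setT) c ->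
     (forall c', ~ step c c') -> c = Returned o).

(* Main.v *)
Require Import Defs.
From Stdlib Require Import Relations.
From mathcomp Require Import all_boot.
From mathcomp Require Import boolp classical_sets.
Local Open Scope classical_set_scope.

(** Let G be the largest phi in L with post(phi) included in phi and phi
    included in P; it exists because L is closed under unions.  Both loops
    keep their variable I in L and above G, and both shrink I strictly at each
    refinement.  Well-quasiordering gives the descending chain condition on L,
    so both terminate.  A returned I satisfies the condition defining G, hence
    equals G, and a failure exhibits some I above G not containing Sigma0.
    Thus both algorithms return G if Sigma0 is included in G, and fail
    otherwise. *)

Lemma closed_under_setI (T : Type) (L : set (set T)) (A B : set T) :
  closed_under_bigcap L -> L A -> L B -> L (A `&` B).
Proof.
move=> Lcap LA LB; have := Lcap [set A; B].
by rewrite bigcap_setU !bigcap_set1; apply=> X [->|->].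
Qed.

Lemma closed_under_setT (T : Type) (L : set (set T)) :
  closed_under_bigcap L -> L setT.
Proof. by move=> Lcap; rewrite -(bigcap_set0 id); apply: Lcap. Qed.

(** Choose [x n] in [S n] but outside [S n.+1]. A pair [i < j] with [x i] below [x j] is
    contradictory: [x j] lies in [S i.+1], and members of [L] are downward closed, so [x i] would
    too. *)
Lemma wqo_no_infinite_descent (T : Type) (L : set (set T)) (S : nat -> set T) :
  well_quasiorder (qo_of L) -> (forall n, L (S n)) ->
  ~ forall n, S n.+1 `<` S n.
Proof.
move=> [_ wqo] LS decr.
have /choice[x xP] n : exists x, S n x /\ ~ S n.+1 x.
  have [_ /existsNP[x /not_implyP nSx]] := decr n.
  by exists x.
have mono m n : (m <= n)%N -> S n `<=` S m.
  elim: n => [|n IHn]; first by rewrite leqn0 => /eqP->.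
  rewrite leq_eqVlt => /predU1P[-> //|]; rewrite ltnS => /IHn.
  by apply: subset_trans; case: (decr n).
have [i [j [ltij xij]]] := wqo x.
have [_ nSxi] := xP i; have [Sxj _] := xP j.
by apply: nSxi; apply: xij => //; exact: mono Sxj.
Qed.

(** Shared by both algorithms. The loop invariant is [L I] and [G] included in [I]; an infinite run
    would be a strictly descending chain in [L], and a stuck configuration can only be
    [Returned o]. *)
Lemma descending_loop_returns (Sigma : Type) (L : set (set Sigma))
    (G : set Sigma) (step : relation (config Sigma)) (o : output Sigma) :
  well_quasiorder (qo_of L) -> L setT ->
  (forall I c, L I -> G `<=` I -> step (Running I) c ->
     (exists J, [/\ c = Running J, L J, G `<=` J & J `<` I]) \/
     c = Returned o) ->
  (forall I, exists c, step (Running I) c) ->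
  (forall o' c, ~ step (Returned o') c) ->
  returns step o.
Proof.
move=> wqo LT progress running_step returned_stop; split.
  move=> [c [c0 cS]].
  have cP n : exists I, [/\ c n = Running I, L I & G `<=` I].
    elim: n => [|n [I [cn LI GI]]]; first by exists setT.
    have := cS n; rewrite cn => /(progress _ _ LI GI)[[J [-> LJ GJ _]]|cn1].
      by exists J.
    by have := cS n.+1; rewrite cn1 => /returned_stop.
  have [S SP] := choice cP.
  apply: (wqo_no_infinite_descent Sigma L S wqo) => n; first by case: (SP n).
  have [cn LI GI] := SP n; have [cn1 _ _] := SP n.+1.
  have := cS n; rewrite cn cn1.
  by move=> /(progress _ _ LI GI)[[J [[->]]]|].
move=> c reach stuck.
have: (exists I, [/\ c = Running I, L I & G `<=` I]) \/ c = Returned o.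
  (* Steps are appended at the end of the run, so that induction carries the invariant forward from
     [setT]. *)
  move: reach {stuck} => /(clos_rt_rtn1 _ _ _ _).
  elim=> [|c1 c2 c12 _ [[I [c1E LI GI]]|c1E]]; first by left; exists setT.
    move: c12; rewrite c1E => /(progress _ _ LI GI)[[J [-> LJ GJ _]]|->];
      last by right.
    by left; exists J.
  by move: c12; rewrite c1E => /returned_stop.
move=> [[I [cE _ _]]|//].
have [c' cc'] := running_step I.
by case: (stuck c'); rewrite cE.
Qed.

Section GreatestInductive.
Variables (Sigma : Type) (tau : set (Sigma * Sigma)) (L : set (set Sigma)).
Variables (Sigma0 P : set Sigma).
Hypotheses (Lcap : closed_under_bigcap L) (Lcup : closed_under_bigcup L).
Hypothesis Lwqo : well_quasiorder (qo_of L).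
Implicit Types (X I : set Sigma).

(** Initial states are left out, so that these sets are closed under all unions, the empty one
    included, and a largest one exists even when no inductive invariant does. *)
Definition inductive_in I : Prop := [/\ L I, post tau I `<=` I & I `<=` P].

Definition greatest_inductive : set Sigma := \bigcup_(I in inductive_in) I.

Local Notation G := greatest_inductive.
Local Notation mu_step I := (mu_hat L (pre_tilde tau I `&` I `&` P)).

Lemma greatest_inductiveP : inductive_in G.
Proof.
split; first by apply: Lcup => I [].
- move=> s' [s [I indI Is] ss']; exists I => //.
  by have [_ postI _] := indI; apply: postI; exists s.
- by move=> s [I [_ _ IP] /IP].
Qed.

Lemma greatest_inductive_max I : inductive_in I -> I `<=` G.
Proof. by move=> indI s Is; exists I. Qed.

Lemma L_mu_hat X : L (mu_hat L X).
Proof. by apply: Lcup => phi []. Qed.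

Lemma mu_hat_sub X : mu_hat L X `<=` X.
Proof. by move=> s [phi [_ phiX] /phiX]. Qed.

Lemma L_Av s : L (Av L s).
Proof. by apply: Lcup => phi []. Qed.

Lemma Av_self s : ~ Av L s s.
Proof. by case=> phi []. Qed.

(** [G] is itself one of the members of [L] united by [mu_hat]: successors of [G] stay in [G], hence
    in [I]. *)
Lemma greatest_inductive_mu_step I : G `<=` I -> G `<=` mu_step I.
Proof.
move=> GI s Gs; have [LG postG GP] := greatest_inductiveP.
exists G => //; split=> // t Gt; split; last exact: GP.
split; last exact: GI.
by move=> t' tt'; apply/GI/postG; exists t.
Qed.

Lemma mu_step_fixpoint I : I = mu_step I -> inductive_in I.
Proof.
move=> IE; have Isub : I `<=` pre_tilde tau I `&` I `&` P.
  by rewrite {1}IE; exact: mu_hat_sub.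
split; first by rewrite IE; exact: L_mu_hat.
- by move=> s' [s /Isub[[preI _] _] /preI].
- by move=> s /Isub[].
Qed.

(** A counterexample [s] cannot lie in [G], since its successors would stay in [I] and [s] in [P].
    So [G] is among the sets united in [Av L s]. *)
Lemma greatest_inductive_Av I s :
  G `<=` I -> counterexample tau P I s -> G `<=` Av L s.
Proof.
move=> GI [_ cex]; have [LG postG GP] := greatest_inductiveP.
move=> t Gt; exists G => //; split=> // Gs.
case: cex => [|/(_ (GP _ Gs))//]; apply=> s' [_ -> ss'].
by apply/GI/postG; exists s.
Qed.

(** Ensures that Algorithm 2 never gets stuck at its choice of [s]. *)
Lemma counterexample_exists I :
  ~ inductive_invariant tau Sigma0 P I -> Sigma0 `<=` I ->
  exists s, counterexample tau P I s.
Proof.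
move=> ninv S0I; apply: contrapT => /forallNP nocex; apply: ninv; split=> //.
- move=> s' [s Is ss']; apply: contrapT => nIs'.
  apply: (nocex s); split=> //; left=> postI.
  by apply/nIs'/postI; exists s.
- by move=> s Is; apply: contrapT => nPs; apply: (nocex s); split=> //; right.
Qed.

(** Depends on [G] and [Sigma0] alone, hence not on the counterexamples chosen. *)
Definition common_output : output Sigma :=
  if `[< Sigma0 `<=` G >] then Invariant G else NoInvariant.

Lemma common_output_invariant I :
  Sigma0 `<=` I -> G `<=` I -> inductive_in I -> Invariant I = common_output.
Proof.
move=> S0I GI indI; have IG : I = G.
  by apply/seteqP; split=> //; exact: greatest_inductive_max.
by rewrite /common_output -IG asboolT.
Qed.

Lemma common_output_none I :
  ~ Sigma0 `<=` I -> G `<=` I -> NoInvariant = common_output.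
Proof.
move=> nS0I GI; rewrite /common_output; case: asboolP => // S0G.
by case: nS0I; exact: subset_trans GI.
Qed.

Lemma alg1_returns : returns (alg1_step tau L Sigma0 P) common_output.
Proof.
apply: (descending_loop_returns _ L G) => //; first exact: closed_under_setT.
- move=> I c LI GI Ic; inversion Ic as [J S0I IE|J S0I IE|J nS0I]; subst.
  + right; congr Returned; apply: common_output_invariant => //.
    exact: mu_step_fixpoint.
  + have subI : mu_step I `<=` I by move=> s /mu_hat_sub[[]].
    left; exists (I `&` mu_step I); split=> //.
    * by apply: closed_under_setI => //; exact: L_mu_hat.
    * by move=> s Gs; split; [exact: GI|exact: greatest_inductive_mu_step Gs].
    (* Without strict decrease, [I] would equal [mu_step I], which the guard of the refinement
       excludes. *)
    * split=> [s []//|Isub]; apply: IE.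
      by apply/seteqP; split=> // s /Isub[].
  + by right; congr Returned; exact: (common_output_none I).
- move=> I; have [S0I|nS0I] := pselect (Sigma0 `<=` I); last first.
    by eexists; exact: Alg1Exit.
  have [IE|IE] := pselect (I = mu_step I).
    by eexists; exact: Alg1Return.
  by eexists; exact: Alg1Refine.
- by move=> o c oc; inversion oc.
Qed.

Lemma alg2_returns : returns (alg2_step tau L Sigma0 P) common_output.
Proof.
apply: (descending_loop_returns _ L G) => //; first exact: closed_under_setT.
- move=> I c LI GI Ic.
  inversion Ic as [J _ nS0I|J s _ S0I cex|J invI]; subst.
  + by right; congr Returned; exact: (common_output_none I).
  + left; exists (I `&` Av L s); split=> //.
    * by apply: closed_under_setI => //; exact: L_Av.
    * move=> t Gt; split; first exact: GI.
      exact: greatest_inductive_Av cex _ Gt.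
    (* The decrease is strict because [s] itself is removed. *)
    * split=> [t []//|Isub]; have [Is _] := cex.
      by have [_ /Av_self] := Isub _ Is.
  (* The exit test does not mention [L]; membership of [I] in [L] comes from the loop invariant. *)
  + have [S0I postI IP] := invI.
    by right; congr Returned; exact: common_output_invariant.
- move=> I; have [invI|ninv] := pselect (inductive_invariant tau Sigma0 P I).
    by eexists; exact: Alg2Exit.
  have [S0I|nS0I] := pselect (Sigma0 `<=` I); last first.
    by eexists; exact: Alg2Fail.
  have [s cex] := counterexample_exists I ninv S0I.
  by eexists; exact: Alg2Refine cex.
- by move=> o c oc; inversion oc.
Qed.

End GreatestInductive.

Theorem theorem5p5 (Sigma : Type) (tau : set (Sigma * Sigma))
    (L : set (set Sigma)) (Sigma0 P : set Sigma)
    (Lcap : closed_under_bigcap L) (Lcup : closed_under_bigcup L)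
    (Lwqo : well_quasiorder (qo_of L)) :
  (exists I : set Sigma,
     [/\ L I, inductive_invariant tau Sigma0 P I,
         returns (alg1_step tau L Sigma0 P) (Invariant I)
       & returns (alg2_step tau L Sigma0 P) (Invariant I)])
  \/ (returns (alg1_step tau L Sigma0 P) NoInvariant
      /\ returns (alg2_step tau L Sigma0 P) NoInvariant).
Proof.
have := alg2_returns Sigma tau L Sigma0 P Lcap Lcup Lwqo.
have := alg1_returns Sigma tau L Sigma0 P Lcap Lcup Lwqo.
rewrite /common_output; case: asboolP => [S0G|_] ret1 ret2; last by right.
have [LG postG GP] := greatest_inductiveP Sigma tau L P Lcup.
by left; exists (greatest_inductive Sigma tau L P).
Qed.
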